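(* For every $a>0$ there exists $\mu(a)>0$ such that for all $G\in\mathcal{S}_G(a)$, $$J(G)-J^*\le\mu(a)\,\|\Pi_{X_-}\nabla J(G)\|,$$ where $J^*=\min_{G\in\mathcal{S}_G}J(G)$ is the optimal LQR cost.
   Context: Setting. Let $A\in\mathbb{R}^{n\times n}$, $B\in\mathbb{R}^{n\times m}$ with $(A,B)$ controllable, and let $Q\in\mathbb{R}^{n\times n}$, $R\in\mathbb{R}^{m\times m}$ be symmetric positive definite. Let $X_-\in\mathbb{R}^{n\times T}$, $U_-\in\mathbb{R}^{m\times T}$, $X_+\in\mathbb{R}^{n\times T}$ be data matrices satisfying $X_+=AX_-+BU_-$, and assume that $D_-=\begin{bmatrix}U_- \\ X_-\end{bmatrix}\in\mathbb{R}^{(m+n)\times T}$ has full row rank $m+n$. For $G\in\mathbb{R}^{T\times n}$ with spectral radius $\rho(X_+G)<1$, let $\Sigma_G$ be the unique solution of $\Sigma_G=I_n+X_+G\Sigma_GG^\top X_+^\top$ and define $$J(G)=\mathrm{Tr}\{(Q+G^\top U_-^\top RU_-G)\Sigma_G\}.$$ The gradient $\nabla J(G)\in\mathbb{R}^{T\times n}$ is that of $J$ as a function on the open set $\{G\in\mathbb{R}^{T\times n}:\rho(X_+G)<1\}$. Feasible set: $\mathcal{S}_G=\{G\in\mathbb{R}^{T\times n}: X_-G=I_n,\ \rho(X_+G)<1\}$. Sublevel sets: $\mathcal{S}_G(a)=\{G\in\mathcal{S}_G: J(G)\le a\}$. $\Pi_{X_-}=I_T-X_-^\dagger X_-$ with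 $X_-^\dagger=X_-^\top(X_-X_-^\top)^{-1}$ is the orthogonal projection onto the nullspace of $X_-$. $\|\cdot\|$ denotes the spectral norm (2-norm) of a matrix. *)

(* Defs.v *)
From mathcomp Require Export all_boot all_order all_algebra.
From mathcomp Require Export all_classical all_reals all_analysis.
From mathcomp Require Export complex.

Set Implicit Arguments.
Unset Strict Implicit.
Unset Printing Implicit Defensive.

Export Order.TTheory GRing.Theory Num.Theory.
Export numFieldNormedType.Exports.

Local Open Scope classical_set_scope.
Local Open Scope ring_scope.

Section Matrices.
Context {R : realType}.

Definition symposdef (n : nat) (M : 'M[R]_n) : Prop :=
  M^T = M /\ forall x : 'cV[R]_n, x != 0 -> 0 < (x^T *m M *m x) 0 0.

(** Kalman rank condition: [B, AB, ..., A^(n-1) B] has rank n. *)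
Definition controllable (n m : nat) (A : 'M[R]_n) (B : 'M[R]_(n, m)) : bool :=
  row_free (\mxrow_(k < n) (A ^+ k *m B)).

(** MathComp's [eigenvalue] refers to left eigenvectors, which does not affect
    the spectrum.  The set is finite, so the supremum is a maximum (it is 0 for
    n = 0). *)
Definition spectral_radius (n : nat) (M : 'M[R]_n) : R :=
  sup [set ComplexField.Normc.normc z |
         z in [set z : R[i] | eigenvalue (map_mx (real_complex R) M) z]].

(** The norm that the library puts on matrices is the maximum of the absolute
    values of the entries, hence the explicit 2-norms. *)
Definition euclidean_norm (n : nat) (x : 'cV[R]_n) : R :=
  Num.sqrt (\sum_i x i 0 ^+ 2).

Definition spectral_norm (p q : nat) (M : 'M[R]_(p, q)) : R :=
  sup [set euclidean_norm (M *m x) |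
         x in [set x : 'cV[R]_q | euclidean_norm x <= 1]].

(** Matrix of partial derivatives, i.e. the gradient for the inner product
    Tr (M^T N).  It depends only on [f] near [G]. *)
Definition gradient (p q : nat) (f : 'M[R]_(p, q) -> R) (G : 'M[R]_(p, q)) :
    'M[R]_(p, q) :=
  \matrix_(i, j) 'D_(delta_mx i j) f G.

(** The least element of [E] (0 if there is none). *)
Definition set_min (E : set R) : R := xget 0 (E `&` lbound E).

(** Moore-Penrose inverse of a matrix of full row rank. *)
Definition right_pinv (p q : nat) (X : 'M[R]_(p, q)) : 'M[R]_(q, p) :=
  X^T *m invmx (X *m X^T).

Definition null_proj (p q : nat) (X : 'M[R]_(p, q)) : 'M[R]_q :=
  1%:M - right_pinv X *m X.

End Matrices.

Section DataDrivenLQR.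
Context {R : realType} {n m T : nat}.
Variables (Q : 'M[R]_n) (W : 'M[R]_m).
Variables (Xm : 'M[R]_(n, T)) (Um : 'M[R]_(m, T)) (Xp : 'M[R]_(n, T)).

(** The solution of the discrete Lyapunov equation; it exists and is unique when
    [spectral_radius (Xp *m G) < 1], which is the only case of interest: that
    condition is open, so the values elsewhere do not affect the gradient of
    [lqr_cost] where it holds. *)
Definition Sigma (G : 'M[R]_(T, n)) : 'M[R]_n :=
  xget 0 [set S | S = 1%:M + Xp *m G *m S *m G^T *m Xp^T].

(** [W] is the input weight, usually written R. *)
Definition lqr_cost (G : 'M[R]_(T, n)) : R :=
  \tr ((Q + G^T *m Um^T *m W *m Um *m G) *m Sigma G).

Definition feasible : set 'M[R]_(T, n) :=
  [set G | Xm *m G = 1%:M /\ spectral_radius (Xp *m G) < 1].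

Definition sublevel (a : R) : set 'M[R]_(T, n) :=
  [set G | feasible G /\ lqr_cost G <= a].

Definition optimal_cost : R := set_min [set lqr_cost G | G in feasible].

End DataDrivenLQR.

(* Main.v *)
Require Import Defs.
From mathcomp Require Import ring lra.

(** Fix [G], let [P] solve the Lyapunov equation dual to that of [Sigma G], and
    put [L = Um^T W Um + Xp^T P Xp].  For two stabilizing points,
    [J G' - J G = Tr ((G'^T L G' - G^T L G) Sigma G')]; hence the gradient at [G]
    is [2 L G (Sigma G)] and, [L] and [Sigma G'] being positive semidefinite,
    [J G - J G' <= - Tr ((G' - G)^T (gradient at G) (Sigma G)^-1 (Sigma G'))].
    Both [J] and [Sigma] depend on a feasible [G] only through the gain [Um G],
    so [G'] may be taken to be the minimizer moved along the kernel of the data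
    until [G' - G = V (K* - Um G)] with [V] fixed.  As [Xm (G' - G) = 0], the
    gradient may be replaced by its projection; on a sublevel set [Um G] is
    bounded, and [(Sigma G)^-1 <= 1].  The minimum exists because the pairs
    (gain, Lyapunov solution) with bounded cost form a compact set. *)

Set Implicit Arguments.
Unset Strict Implicit.
Unset Printing Implicit Defensive.

Local Open Scope classical_set_scope.
Local Open Scope ring_scope.

(** * Powers of stable matrices *)

(** Bounded partial sums instead of a limit: the same notion then serves real and complex
    entries. *)
Definition abs_summable (F : numDomainType) (u : nat -> F) : Prop :=
  exists C, forall N, \sum_(k < N) `|u k| <= C.

Lemma abs_summable_recurrence (F : numFieldType) (u y : nat -> F) (l : F) :
  `|l| < 1 -> abs_summable y -> (forall k, u k.+1 = l * u k + y k) ->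
  abs_summable u.
Proof.
move=> l1 [C hC] huy; have l1' : 0 < 1 - `|l| by rewrite subr_gt0.
have C0 : 0 <= C by have := hC 0%N; rewrite big_ord0.
(* [K] is the fixed point of [K = |u 0| + |l| K + C], so the induction on partial sums reproduces
   the same bound. *)
exists ((`|u 0%N| + C) / (1 - `|l|)); set K := _ / _.
have hK : `|u 0%N| + C = K * (1 - `|l|) by rewrite divfK ?gt_eqF.
elim=> [|N IH].
  by rewrite big_ord0; apply: divr_ge0; [exact: addr_ge0 | exact: ltW].
rewrite big_ord_recl (_ : K = `|u 0%N| + (`|l| * K + C)); last first.
  by rewrite addrCA hK; ring.
rewrite lerD2l; apply: le_trans (lerD (ler_wpM2l (normr_ge0 l) IH) (hC N)).
rewrite mulr_sumr -big_split /=; apply: ler_sum => k _.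
by rewrite -normrM (le_trans _ (ler_normD _ _)) -?huy.
Qed.

(** Peel off one factor [M - l] at a time: [N M^k] obeys a scalar recurrence of ratio [l] whose
    forcing term [N (M - l) M^k] is annihilated by the remaining factors. *)
Lemma abs_summable_mulmx_pow (F : numFieldType) (n : nat) (M N : 'M[F]_n)
    (s : seq F) :
  {in s, forall l, `|l| < 1} ->
  N *m \big[mulmx/1%:M]_(l <- s) (M - l%:M) = 0 ->
  forall i j, abs_summable (fun k => (N *m M ^+ k) i j).
Proof.
elim: s N => [|l s IH] N hs hN i j.
  exists 0 => m; rewrite big1 // => k _.
  by move: hN; rewrite big_nil mulmx1 => ->; rewrite mul0mx mxE normr0.
apply: (@abs_summable_recurrence _ _ (fun k => (N *m (M - l%:M) *m M ^+ k) i j) l).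
- by apply: hs; rewrite mem_head.
- apply: IH => [z zs|]; first by apply: hs; rewrite in_cons zs orbT.
  by move: hN; rewrite big_cons mulmxA.
- move=> k; suff -> : N *m M ^+ k.+1 =
      l *: (N *m M ^+ k) + N *m (M - l%:M) *m M ^+ k.
    by rewrite [LHS]mxE [X in X + _]mxE.
  by rewrite exprS mulmxBr mul_mx_scalar mulmxBl -scalemxAl addrC subrK -mulmxA.
Qed.

(** Cayley-Hamilton: the characteristic polynomial splits, its roots are the eigenvalues, and the
    product of the factors [M - l] vanishes. *)
Lemma abs_summable_pow (F : numClosedFieldType) (n : nat) (M : 'M[F]_n) :
  (forall l, eigenvalue M l -> `|l| < 1) ->
  forall i j, abs_summable (fun k => (M ^+ k) i j).
Proof.
case: n M => [|n] M hM i j; first by case: i.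
have [s hs] := closed_field_poly_normal (char_poly M).
move: hs; rewrite (monicP (char_poly_monic M)) scale1r => hs.
suff : abs_summable (fun k => (1%:M *m M ^+ k) i j).
  by case=> C hC; exists C => N; have := hC N; under eq_bigr do rewrite mul1mx.
apply: (@abs_summable_mulmx_pow _ _ M 1%:M s) => [l ls|].
  by apply: hM; rewrite eigenvalue_root_char hs root_prod_XsubC.
rewrite mul1mx -(Cayley_Hamilton M) hs rmorph_prod /=.
by apply: eq_bigr => l _; rewrite rmorphB /= horner_mx_X horner_mx_C.
Qed.

(** * Entrywise norm and decay of powers of real matrices *)

Section Stability.
Context {R : realType}.

(** The working norm for all estimates: submultiplicative, invariant under transposition, and
    dominating both entries and trace. *)
Definition l1_norm (p q : nat) (M : 'M[R]_(p, q)) : R :=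
  \sum_i \sum_j `|M i j|.

Lemma l1_norm_ge0 (p q : nat) (M : 'M[R]_(p, q)) : 0 <= l1_norm M.
Proof. by rewrite sumr_ge0 // => i _; rewrite sumr_ge0. Qed.

Lemma ler_entry_l1_norm (p q : nat) (M : 'M[R]_(p, q)) i j :
  `|M i j| <= l1_norm M.
Proof.
rewrite /l1_norm (bigD1 i) //= (bigD1 j) //= -addrA lerDl addr_ge0 ?sumr_ge0 //.
by move=> a _; rewrite sumr_ge0.
Qed.

Lemma l1_norm_eq0 (p q : nat) (M : 'M[R]_(p, q)) : l1_norm M <= 0 -> M = 0.
Proof.
move=> h; apply/matrixP => i j; rewrite mxE; apply/eqP.
by rewrite -normr_le0 (le_trans (ler_entry_l1_norm M i j)).
Qed.

Lemma l1_norm_le (p q : nat) (M : 'M[R]_(p, q)) c :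
  (forall i j, `|M i j| <= c) -> l1_norm M <= c *+ (q * p).
Proof.
move=> h; rewrite mulrnA -[X in _ *+ X]card_ord -sumr_const.
apply: ler_sum => i _; rewrite -[X in _ *+ X]card_ord -sumr_const.
by apply: ler_sum => j _.
Qed.

Lemma l1_norm_tr (p q : nat) (M : 'M[R]_(p, q)) : l1_norm M^T = l1_norm M.
Proof.
rewrite /l1_norm exchange_big; apply: eq_bigr => i _; apply: eq_bigr => j _.
by rewrite mxE.
Qed.

Lemma ler_l1_norm_mul (p q r : nat) (M : 'M[R]_(p, q)) (N : 'M[R]_(q, r)) :
  l1_norm (M *m N) <= l1_norm M * l1_norm N.
Proof.
rewrite /l1_norm mulr_suml; apply: ler_sum => i _.
apply: (@le_trans _ _ (\sum_j `|M i j| * \sum_k `|N j k|)).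
  under [leRHS]eq_bigr do rewrite mulr_sumr.
  rewrite exchange_big; apply: ler_sum => k _; rewrite mxE.
  by apply: le_trans (ler_norm_sum _ _ _) _; apply: ler_sum => j _; rewrite normrM.
rewrite mulr_suml; apply: ler_sum => j _; apply: ler_wpM2l => //.
by rewrite [leRHS](bigD1 j) //= lerDl sumr_ge0 // => k _; rewrite sumr_ge0.
Qed.

Lemma ler_norm_mxtrace (n : nat) (M : 'M[R]_n) : `|\tr M| <= l1_norm M.
Proof.
apply: le_trans (ler_norm_sum _ _ _) _; apply: ler_sum => i _.
by rewrite [leRHS](bigD1 i) //= lerDl sumr_ge0.
Qed.

(** The form in which stability is used: one small power at a time suffices, without a rate or a
    limit. *)
Definition small_powers (n : nat) (M : 'M[R]_n) : Prop :=
  forall e, 0 < e -> exists k, l1_norm (M ^+ k.+1) <= e.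

Lemma normc_norm (z : R[i]) : `|z| = (ComplexField.Normc.normc z)%:C%C.
Proof. by []. Qed.

(** The eigenvalues are the finitely many roots of the characteristic polynomial; this makes the
    supremum in [spectral_radius] a true upper bound. *)
Lemma eigenvalue_normc_bounded (n : nat) (M : 'M[R[i]]_n) :
  exists C, forall z, eigenvalue M z -> ComplexField.Normc.normc z <= C.
Proof.
have [s hs] := closed_field_poly_normal (char_poly M).
move: hs; rewrite (monicP (char_poly_monic M)) scale1r => hs.
exists (\sum_(z <- s) ComplexField.Normc.normc z) => z.
rewrite eigenvalue_root_char hs root_prod_XsubC => zs.
have normc_ge0 (x : R[i]) : 0 <= ComplexField.Normc.normc x.
  by case: x => a b; exact: sqrtr_ge0.
by rewrite (big_rem _ zs) /= lerDl sumr_ge0.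
Qed.

Lemma spectral_radius_lt1_eigenvalue (n : nat) (M : 'M[R]_n) (z : R[i]) :
  spectral_radius M < 1 -> eigenvalue (map_mx (real_complex R) M) z ->
  `|z| < 1.
Proof.
move=> h hz; rewrite normc_norm (_ : 1 = 1%:C%C) // ltcR.
apply: le_lt_trans h; apply: sup_upper_bound; last by exists z.
split; first by exists (ComplexField.Normc.normc z), z.
have [C hC] := eigenvalue_normc_bounded (map_mx (real_complex R) M).
by exists C => _ [y hy <-]; exact: hC.
Qed.

(** The norms of the powers have bounded partial sums, so they cannot all stay above a positive
    [e]. *)
Lemma spectral_radius_small_powers (n : nat) (M : 'M[R]_n) :
  spectral_radius M < 1 -> small_powers M.
Proof.
move=> h e e0.
have hs i j : abs_summable (fun k => (M ^+ k) i j).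
  have [C hC] := abs_summable_pow
    (fun l => @spectral_radius_lt1_eigenvalue _ _ l h) i j.
  (* The partial sums are real, so being below [C] in the complex order means being below its real
     part. *)
  exists (complex.Re C) => N; have := hC N.
  have hM k : `|(map_mx (real_complex R) M ^+ k) i j| = (`|(M ^+ k) i j|)%:C%C.
    rewrite -rmorphXn mxE normc_norm /=.
    by rewrite expr0n addr0 sqrtr_sqr.
  under eq_bigr do rewrite hM.
  rewrite -rmorph_sum /=; case: {hC} C => a b /=.
  by rewrite lecE /= => /andP[].
pose v k := l1_norm (M ^+ k).
have [C hC] : exists C, forall N, \sum_(k < N) v k <= C.
  pose c i j := sval (cid (hs i j)).
  exists (\sum_i \sum_j c i j) => N; rewrite /v exchange_big /=.
  apply: ler_sum => i _; rewrite exchange_big /=; apply: ler_sum => j _.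
  exact: (svalP (cid (hs i j))).
have v0 k : 0 <= v k := l1_norm_ge0 _.
apply: contrapT => /forallNP hn.
have {}hn k : e <= v k.+1 by have /negP := hn k; rewrite -ltNge => /ltW.
have C0 : 0 <= C by have := hC 0%N; rewrite big_ord0.
(* With this [N], [e *+ N] exceeds [C]; the power of exponent 0 is set aside, the lower bound [e]
   being known for positive exponents. *)
pose N := (Num.truncn (C / e)).+1.
have := hC N.+1; rewrite big_ord_recl => hh.
have : e *+ N <= C.
  apply: le_trans hh; rewrite ler_wpDl //.
  rewrite -[X in _ *+ X]card_ord -sumr_const; apply: ler_sum => k _.
  by rewrite lift0.
rewrite leNgt -mulr_natl -ltr_pdivrMr // => /negP; apply.
by rewrite truncnS_gt // divr_ge0 // ltW.
Qed.

End Stability.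

(** * Lyapunov equations *)

Section Positivity.
Context {R : realType}.

Definition psd (n : nat) (N : 'M[R]_n) : Prop :=
  forall x : 'cV[R]_n, 0 <= (x^T *m N *m x) 0 0.

(* The cone dual to the quadratic-form one; for symmetric matrices the two
   cones coincide, but the dual description spares the spectral theorem. *)
Definition dual_psd (n : nat) (S : 'M[R]_n) : Prop :=
  forall N : 'M[R]_n, psd N -> 0 <= \tr (N *m S).

Lemma quad_trace (n : nat) (N : 'M[R]_n) (x : 'cV[R]_n) :
  (x^T *m N *m x) 0 0 = \tr (N *m (x *m x^T)).
Proof. by rewrite mulmxA mxtrace_mulC mulmxA [RHS]big_ord1. Qed.

Lemma sqr_quad (n : nat) (x : 'cV[R]_n) :
  (x^T *m x) 0 0 = \sum_i x i 0 ^+ 2.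
Proof. by rewrite mxE; apply: eq_bigr => i _; rewrite mxE expr2. Qed.

Lemma dual_psd_gram (n : nat) (x : 'cV[R]_n) : dual_psd (x *m x^T).
Proof. by move=> N hN; rewrite -quad_trace. Qed.

(** Pair [S] with [x x^T], whose quadratic form at [y] is the square of [x^T y]. *)
Lemma dual_psd_psd (n : nat) (S : 'M[R]_n) : dual_psd S -> psd S.
Proof.
move=> hS x; rewrite quad_trace mxtrace_mulC; apply: hS => y.
rewrite mulmxA -mulmxA mxE big_ord1.
have -> : (x^T *m y) 0 0 = (y^T *m x) 0 0.
  by rewrite -[in LHS](trmxK y) -trmx_mul mxE.
exact: sqr_ge0.
Qed.

Lemma psdD (n : nat) (M N : 'M[R]_n) : psd M -> psd N -> psd (M + N).
Proof. by move=> hM hN x; rewrite mulmxDr mulmxDl mxE addr_ge0. Qed.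

Lemma psd_congr (p q : nat) (N : 'M[R]_p) (Y : 'M[R]_(p, q)) :
  psd N -> psd (Y^T *m N *m Y).
Proof.
by move=> hN x; have := hN (Y *m x); rewrite trmx_mul !mulmxA.
Qed.

Lemma psd1 (n : nat) : psd (1%:M : 'M[R]_n).
Proof.
by move=> x; rewrite mulmx1 sqr_quad sumr_ge0 // => i _; rewrite sqr_ge0.
Qed.

Lemma symposdef_psd (n : nat) (N : 'M[R]_n) : symposdef N -> psd N.
Proof.
move=> [_ hN] x; have [->|/hN/ltW //] := eqVneq x 0.
by rewrite mulmx0 mxE.
Qed.

Lemma dual_psd1 (n : nat) : dual_psd (1%:M : 'M[R]_n).
Proof.
move=> N hN; rewrite mulmx1 sumr_ge0 // => i _.
have := hN (delta_mx i 0); by rewrite trmx_delta -rowE -colE !mxE.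
Qed.

Lemma symposdef_unitmx (n : nat) (N : 'M[R]_n) : symposdef N -> N \in unitmx.
Proof.
move=> [_ hN]; rewrite unitmxE unitfE; apply/negP => /eqP/eqP/det0P[v v0 hv].
have := hN v^T; rewrite trmxK hv mul0mx mxE ltxx.
by rewrite -[X in _ != X]trmx0 (inj_eq trmx_inj) => /(_ v0).
Qed.

(** Cauchy-Schwarz for the inner product of [Q], against the columns of the inverse of [Q], bounds
    each squared coordinate of [x] by a multiple of [x^T Q x]. *)
Lemma symposdef_coercive (n : nat) (Q : 'M[R]_n) : symposdef Q ->
  exists q : R, 0 < q /\ psd (Q - q%:M).
Proof.
move=> hQ; have Qu := symposdef_unitmx hQ.
have hx (x : 'cV[R]_n) i : 0 < invmx Q i i /\
    x i 0 ^+ 2 <= invmx Q i i * (x^T *m Q *m x) 0 0.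
  set c := invmx Q i i; pose y : 'cV[R]_n := col i (invmx Q).
  have Qy : Q *m y = delta_mx i 0 by rewrite /y colE mulmxA mulmxV // mul1mx.
  have ye (z : 'cV[R]_n) : (z^T *m Q *m y) 0 0 = z i 0.
    by rewrite -mulmxA Qy -colE !mxE.
  have yz (z : 'cV[R]_n) : (y^T *m Q *m z) 0 0 = z i 0.
    rewrite -(ye z) -[in RHS](trmxK (z^T *m Q *m y)) [RHS]mxE.
    by rewrite !trmx_mul trmxK hQ.1 mulmxA.
  have y0 : y != 0.
    apply/eqP => y0; have := ye (delta_mx i 0).
    rewrite y0 mulmx0 !mxE !eqxx => /eqP; by rewrite eq_sym oner_eq0.
  have yQy : (y^T *m Q *m y) 0 0 = c by rewrite ye mxE.
  have c0 : 0 < c by rewrite -yQy; apply: hQ.2.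
  split=> //.
  (* At this point, the projection of [x] orthogonal to [y], the form equals
     [x^T Q x - x_i^2 / c]. *)
  have := symposdef_psd hQ (x - (x i 0 / c) *: y).
  set a := x i 0 / c.
  have -> : (x - a *: y)^T = x^T - a *: y^T by rewrite linearB linearZ.
  have -> : (x^T - a *: y^T) *m Q *m (x - a *: y) =
      x^T *m Q *m x - a *: (y^T *m Q *m x) - a *: (x^T *m Q *m y)
      + (a * a) *: (y^T *m Q *m y).
    rewrite !mulmxBl mulmxBr -!scalemxAl mulmxBr -!scalemxAr -scalerA.
    rewrite scalerBr opprB -!addrA; congr (_ + _).
    by rewrite addrCA; congr (_ + _); rewrite addrC.
  have E (U V W Z : 'M[R]_1) : (U - a *: V - a *: W + (a * a) *: Z) 0 0 =
      U 0 0 - a * V 0 0 - a * W 0 0 + (a * a) * Z 0 0 by rewrite !mxE.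
  rewrite E ye yz yQy /a; set X := (x^T *m Q *m x) 0 0.
  move=> h; rewrite -(ler_pM2r (_ : 0 < c^-1)) ?invr_gt0 //.
  rewrite [leRHS]mulrAC divff ?gt_eqF // mul1r -subr_ge0.
  apply: le_trans h _; rewrite le_eqVlt; apply/orP; left; apply/eqP.
  by field; rewrite gt_eqF.
pose t := \sum_i invmx Q i i.
have t0 : 0 <= t by rewrite sumr_ge0 // => i _; rewrite ltW // (hx 0 i).1.
have t1 : 0 < 1 + t by rewrite ltr_pwDl.
(* The summand 1 keeps the denominator positive when [n = 0]. *)
exists (1 + t)^-1; split; first by rewrite invr_gt0.
move=> x; rewrite mulmxBr mulmxBl mul_mx_scalar -scalemxAl mxE [X in _ + X]mxE.
rewrite [X in _ - X]mxE sqr_quad subr_ge0 mulrC ler_pdivrMr // mulrC.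
have xx : 0 <= (x^T *m Q *m x) 0 0 := symposdef_psd hQ x.
apply: (@le_trans _ _ (t * (x^T *m Q *m x) 0 0)); last first.
  by rewrite ler_wpM2r // lerDr.
by rewrite mulr_suml; apply: ler_sum => i _; exact: (hx x i).2.
Qed.

End Positivity.

(** * The discrete Lyapunov equation *)

Section Lyapunov.
Context {R : realType}.

(** Matrix of the operator [S - M S M^T] of [S], acting on vectorized matrices. Its determinant is
    continuous in [M], so its nonvanishing persists near a stable matrix. *)
Definition lyap_mx (n : nat) (M : 'M[R]_n) : 'M[R]_(n * n) :=
  1%:M - lin_mulmx M *m lin_mulmxr M^T.

Lemma mul_mxvec_lyap (n : nat) (M S : 'M[R]_n) :
  mxvec S *m lyap_mx M = mxvec (S - M *m S *m M^T).
Proof. by rewrite mulmxBr mulmx1 mulmxA !mul_vec_lin /= linearB. Qed.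

Lemma lyap_uniq (n : nat) (M Z S1 S2 : 'M[R]_n) : \det (lyap_mx M) != 0 ->
  S1 = Z + M *m S1 *m M^T -> S2 = Z + M *m S2 *m M^T -> S1 = S2.
Proof.
move=> hd h1 h2; apply: (can_inj mxvecK).
have /row_free_inj : row_free (lyap_mx M) by rewrite row_free_unit unitmxE unitfE.
apply; rewrite !mul_mxvec_lyap; congr mxvec.
by rewrite {1}h1 {1}h2 !addrK.
Qed.

Lemma lyap_exists (n : nat) (M Z : 'M[R]_n) : \det (lyap_mx M) != 0 ->
  exists S, S = Z + M *m S *m M^T.
Proof.
move=> hd; exists (vec_mx (mxvec Z *m invmx (lyap_mx M))); set S := vec_mx _.
apply/eqP; rewrite -subr_eq; apply/eqP; apply: (can_inj mxvecK).
by rewrite -mul_mxvec_lyap vec_mxK mulmxKV // unitmxE unitfE.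
Qed.

Lemma lyap_iter (n : nat) (M S : 'M[R]_n) k : S = M *m S *m M^T ->
  S = M ^+ k *m S *m (M ^+ k)^T.
Proof.
move=> h; elim: k => [|k IH]; first by rewrite expr0 trmx1 mul1mx mulmx1.
rewrite {1}IH {1}h exprSr -mulmxE trmx_mul !mulmxA; congr (_ *m _ *m _ *m _).
Qed.

(** A kernel element satisfies [S = M^k S (M^k)^T] for all [k]; a power of norm at most 1/2 gives
    [|S| <= |S| / 4]. *)
Lemma small_powers_det (n : nat) (M : 'M[R]_n) :
  small_powers M -> \det (lyap_mx M) != 0.
Proof.
move=> hM; apply/negP => /eqP/eqP/det0P[v v0].
rewrite -(vec_mxK v) mul_mxvec_lyap => /(canRL mxvecK); rewrite linear0.
move/subr0_eq; set S := vec_mx v => /lyap_iter hS.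
have [k hk] := hM (1 / 2) ltac:(by []).
move/eqP: v0; apply; rewrite -(vec_mxK v) (_ : vec_mx v = 0) ?linear0 //.
apply: l1_norm_eq0; have := l1_norm_ge0 S; rewrite -/S.
have : l1_norm S <= 1 / 4 * l1_norm S.
  rewrite {1}(hS k.+1); apply: le_trans (ler_l1_norm_mul _ _) _.
  rewrite l1_norm_tr (_ : 1 / 4 * _ = 1 / 2 * l1_norm S * (1 / 2)); last by field.
  apply: ler_pM => //; rewrite ?l1_norm_ge0 //.
  by apply: le_trans (ler_l1_norm_mul _ _) _; rewrite ler_wpM2r ?l1_norm_ge0.
lra.
Qed.

Lemma small_powers_tr (n : nat) (M : 'M[R]_n) :
  small_powers M -> small_powers M^T.
Proof.
move=> hM e /hM [k hk]; exists k.
rewrite (_ : _ ^+ _ = (M ^+ k.+1)^T) ?l1_norm_tr //.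
elim: k.+1 => [|j IH]; first by rewrite !expr0 trmx1.
by rewrite exprS IH exprSr -!mulmxE trmx_mul.
Qed.

(** Unrolling the equation [k] times and dropping nonnegative terms leaves [tr ((M^k)^T N M^k S)] as
    a lower bound of [tr (N S)]; it is arbitrarily small for suitable [k]. *)
Lemma dual_psd_lyap (n : nat) (M Z S : 'M[R]_n) :
  small_powers M -> dual_psd Z -> S = Z + M *m S *m M^T -> dual_psd S.
Proof.
move=> hM hZ hS N hN.
have step k : \tr ((M ^+ k)^T *m N *m M ^+ k *m S) <= \tr (N *m S).
  elim: k => [|k IH]; first by rewrite expr0 trmx1 mul1mx mulmx1.
  apply: le_trans IH; rewrite [in leRHS]hS mulmxDr linearD /= ler_wpDl //.
    by apply: hZ; apply: psd_congr.
  by rewrite exprSr -mulmxE trmx_mul !mulmxA [leRHS]mxtrace_mulC !mulmxA.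
pose c := l1_norm N * l1_norm S.
have c0 : 0 <= c by rewrite mulr_ge0 ?l1_norm_ge0.
apply/ler_addgt0Pr => e e0.
(* The remainder is at most [|X|^2 c]: the bound 1 absorbs one factor [|X|], the other bound turns
   [|X| c] into at most [e]. *)
have d0 : 0 < Num.min 1 (e / (1 + c)) by rewrite lt_min ltr01 divr_gt0 // ltr_pwDl.
have [k hk] := hM _ d0; move: hk; rewrite le_min => /andP[hk1 hk2].
rewrite -lerBlDr sub0r; apply: le_trans (step k.+1); rewrite lerNl.
apply: le_trans (ler_norm _) _; rewrite normrN.
apply: le_trans (ler_norm_mxtrace _) _.
set X := M ^+ _ in hk1 hk2 *; have X0 := l1_norm_ge0 X.
have N0 := l1_norm_ge0 N; have S0 := l1_norm_ge0 S.
apply: (@le_trans _ _ (l1_norm X * l1_norm N * l1_norm X * l1_norm S)).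
  apply: le_trans (ler_l1_norm_mul _ _) _; apply: ler_wpM2r => //.
  apply: le_trans (ler_l1_norm_mul _ _) _; apply: ler_wpM2r => //.
  by apply: le_trans (ler_l1_norm_mul _ _) _; rewrite l1_norm_tr.
have -> : l1_norm X * l1_norm N * l1_norm X * l1_norm S =
    l1_norm X * (l1_norm X * c).
  by rewrite /c; ring.
apply: (@le_trans _ _ (l1_norm X * c)).
  by rewrite ler_piMl // mulr_ge0.
apply: (@le_trans _ _ (e / (1 + c) * c)); first exact: ler_wpM2r.
by rewrite mulrAC ler_pdivrMr ?ltr_pwDl // ler_wpM2l ?ltW // ltrDr.
Qed.

(** The two Lyapunov operators are adjoint for the trace pairing: both sides are
    [tr (P S) - tr (P M S M^T)]. *)
Lemma lyap_duality (n : nat) (M Y Z P S : 'M[R]_n) :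
  P = Z + M^T *m P *m M -> S = Y + M *m S *m M^T -> \tr (P *m Y) = \tr (Z *m S).
Proof.
move=> hP hS.
have -> : Y = S - M *m S *m M^T by rewrite {1}hS addrK.
have -> : Z = P - M^T *m P *m M by rewrite {1}hP addrK.
rewrite mulmxBr mulmxBl !linearB /=; congr (_ - _).
by rewrite !mulmxA mxtrace_mulC !mulmxA.
Qed.

(** By duality [x^T P x = tr (Z S)], where [S] solves the adjoint equation with source [x x^T]. *)
Lemma psd_lyap (n : nat) (M Z P : 'M[R]_n) :
  small_powers M -> psd Z -> P = Z + M^T *m P *m M -> psd P.
Proof.
move=> hM hZ hP x; rewrite quad_trace.
have [S hS] := lyap_exists (x *m x^T) (small_powers_det hM).
rewrite (lyap_duality hP hS).
exact: (dual_psd_lyap hM (@dual_psd_gram _ _ x) hS).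
Qed.

Lemma lyap_sym (n : nat) (M Z S : 'M[R]_n) : \det (lyap_mx M) != 0 ->
  Z^T = Z -> S = Z + M *m S *m M^T -> S^T = S.
Proof.
move=> hd hZ hS; apply: (lyap_uniq (Z := Z) hd) => //.
by rewrite {1}hS linearD /= !trmx_mul trmxK hZ mulmxA.
Qed.

Lemma dual_psd_lyap_sub1 (n : nat) (M S : 'M[R]_n) :
  dual_psd S -> S = 1%:M + M *m S *m M^T -> dual_psd (S - 1%:M).
Proof.
move=> dS hS N hN; rewrite {1}hS addrAC subrr add0r.
rewrite !mulmxA mxtrace_mulC !mulmxA; exact: dS (psd_congr _ hN).
Qed.

End Lyapunov.

(** * Continuity of Lyapunov solutions *)

Section EntrywiseContinuity.
Context {R : realType} {T : topologicalType}.

(** Stated entrywise, so that products, determinants and adjugates reduce to scalar sums and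
    products. *)
Definition mx_continuous (p q : nat) (f : T -> 'M[R]_(p, q)) : Prop :=
  forall i j, continuous (fun t => f t i j : R^o).

Lemma continuous_sum (I : Type) (r : seq I) (P : pred I) (F : I -> T -> R^o) :
  (forall i, P i -> continuous (F i)) ->
  continuous (fun t => \sum_(i <- r | P i) F i t : R^o).
Proof. by move=> h; apply: continuous_big => //; exact: add_continuous. Qed.

Lemma continuous_prod (I : Type) (r : seq I) (P : pred I) (F : I -> T -> R^o) :
  (forall i, P i -> continuous (F i)) ->
  continuous (fun t => \prod_(i <- r | P i) F i t : R^o).
Proof. by move=> h; apply: continuous_big => //; exact: mul_continuous. Qed.

Lemma mx_continuous_cst (p q : nat) (M : 'M[R]_(p, q)) :
  mx_continuous (fun=> M).
Proof. by move=> i j x; exact: cvg_cst. Qed.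

Lemma mx_continuousD (p q : nat) (f g : T -> 'M[R]_(p, q)) :
  mx_continuous f -> mx_continuous g -> mx_continuous (fun t => f t + g t).
Proof.
move=> hf hg i j; under [X in continuous X]eq_fun do rewrite mxE.
by move=> x; apply: cvgD; [exact: hf | exact: hg].
Qed.

Lemma mx_continuousB (p q : nat) (f g : T -> 'M[R]_(p, q)) :
  mx_continuous f -> mx_continuous g -> mx_continuous (fun t => f t - g t).
Proof.
move=> hf hg i j; under [X in continuous X]eq_fun do rewrite !mxE.
by move=> x; apply: cvgB; [exact: hf | exact: hg].
Qed.

Lemma mx_continuousZ (p q : nat) (a : T -> R^o) (f : T -> 'M[R]_(p, q)) :
  continuous a -> mx_continuous f -> mx_continuous (fun t => a t *: f t).
Proof.
move=> ha hf i j; under [X in continuous X]eq_fun do rewrite mxE.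
by move=> x; apply: cvgM; [exact: ha | exact: hf].
Qed.

Lemma mx_continuous_mul (p q r : nat) (f : T -> 'M[R]_(p, q))
    (g : T -> 'M[R]_(q, r)) :
  mx_continuous f -> mx_continuous g -> mx_continuous (fun t => f t *m g t).
Proof.
move=> hf hg i j; under [X in continuous X]eq_fun do rewrite mxE.
apply: continuous_sum => k _ x.
by apply: cvgM; [exact: hf | exact: hg].
Qed.

Lemma mx_continuous_tr (p q : nat) (f : T -> 'M[R]_(p, q)) :
  mx_continuous f -> mx_continuous (fun t => (f t)^T).
Proof.
by move=> hf i j; under [X in continuous X]eq_fun do rewrite mxE; exact: hf.
Qed.

Lemma mx_continuous_vec_mx (p q : nat) (f : T -> 'rV[R]_(p * q)) :
  mx_continuous f -> mx_continuous (fun t => vec_mx (f t)).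
Proof.
by move=> hf i j; under [X in continuous X]eq_fun do rewrite mxE; exact: hf.
Qed.

Lemma mx_continuous_mxvec (p q : nat) (f : T -> 'M[R]_(p, q)) :
  mx_continuous f -> mx_continuous (fun t => mxvec (f t)).
Proof.
move=> hf i j; rewrite (ord1 i); case/mxvec_indexP: j => a b.
by under [X in continuous X]eq_fun do rewrite mxvecE; exact: hf.
Qed.

Lemma continuous_mxtrace (n : nat) (f : T -> 'M[R]_n) :
  mx_continuous f -> continuous (fun t => \tr (f t) : R^o).
Proof. by move=> hf; apply: continuous_sum => i _; exact: hf. Qed.

Lemma continuous_det (n : nat) (f : T -> 'M[R]_n) :
  mx_continuous f -> continuous (fun t => \det (f t) : R^o).
Proof.
move=> hf; apply: continuous_sum => s _ x; apply: cvgM; first exact: cvg_cst.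
by apply: continuous_prod => i _; exact: hf.
Qed.

Lemma mx_continuous_adj (n : nat) (f : T -> 'M[R]_n) :
  mx_continuous f -> mx_continuous (fun t => \adj (f t)).
Proof.
move=> hf i j; under [X in continuous X]eq_fun do rewrite mxE /cofactor.
move=> x; apply: cvgM; first exact: cvg_cst.
apply: continuous_det => a b.
by under [X in continuous X]eq_fun do rewrite !mxE; exact: hf.
Qed.

Lemma mx_continuous_lyap (n : nat) (f : T -> 'M[R]_n) :
  mx_continuous f -> mx_continuous (fun t => lyap_mx (f t)).
Proof.
move=> hf i j; pose D : 'M[R]_n := vec_mx (delta_mx 0 i).
(* Row [i] of the matrix is the image of the basis matrix [D] under the operator. *)
have -> : (fun t => lyap_mx (f t) i j) =
    (fun t => mxvec (D - f t *m D *m (f t)^T) 0 j).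
  apply/funext => t; rewrite -mul_mxvec_lyap vec_mxK.
  by rewrite -rowE [RHS]mxE.
apply: mx_continuous_mxvec; apply: mx_continuousB; first exact: mx_continuous_cst.
apply: mx_continuous_mul; last exact: mx_continuous_tr.
by apply: mx_continuous_mul => //; exact: mx_continuous_cst.
Qed.

End EntrywiseContinuity.

Section LyapunovContinuity.
Context {R : realType} {T : topologicalType}.

(* By Cramer's rule, [det (lyap_mx M) *: S] is continuous in [M]. *)
Lemma lyap_cvg (n : nat) (x : T) (f S : T -> 'M[R]_n) :
  mx_continuous f -> \det (lyap_mx (f x)) != 0 ->
  (forall t, \det (lyap_mx (f t)) != 0 -> S t = 1%:M + f t *m S t *m (f t)^T) ->
  (\forall t \near x, \det (lyap_mx (f t)) != 0) /\
  forall i j, S t i j @[t --> x] --> (S x i j : R^o).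
Proof.
move=> hf hx hS.
pose d t : R^o := \det (lyap_mx (f t)).
have cd : continuous d by apply: continuous_det; exact: mx_continuous_lyap.
pose C t : 'M[R]_n := vec_mx (mxvec 1%:M *m \adj (lyap_mx (f t))).
have cC : mx_continuous C.
  apply: mx_continuous_vec_mx; apply: mx_continuous_mul.
    exact: mx_continuous_cst.
  by apply: mx_continuous_adj; exact: mx_continuous_lyap.
have hC t : d t != 0 -> S t = (d t)^-1 *: C t.
  move=> dt; apply: (lyap_uniq dt (hS t dt)).
  apply/eqP; rewrite -subr_eq -scalemxAr -scalemxAl -scalerBr; apply/eqP.
  apply: (can_inj mxvecK); rewrite linearZ /= -mul_mxvec_lyap vec_mxK -mulmxA.
  by rewrite mul_adj_mx mul_mx_scalar scalerA mulVf // scale1r.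
have nd : \forall t \near x, d t != 0.
  have : nbhs (d x) [set y | y != 0].
    by apply: open_nbhs_nbhs; split => //; exact: open_neq.
  exact: cd.
split=> // i j; rewrite hC // mxE.
apply: (@cvg_trans _ ((d t)^-1 * C t i j @[t --> x])).
  apply: near_eq_cvg; near=> t; rewrite hC ?mxE //; near: t; exact: nd.
by apply: cvgM; [apply: cvgV => //; exact: cd | exact: cC].
Unshelve. all: by end_near. Qed.

End LyapunovContinuity.

(** * The cost and its gradient *)

Section LyapunovSpectrum.
Context {R : realType}.

Lemma psd_bound (n : nat) (S : 'M[R]_n) (x : 'cV[R]_n) :
  (x^T *m S *m x) 0 0 <= l1_norm S * (x^T *m x) 0 0.
Proof.
rewrite quad_trace /mxtrace sqr_quad /l1_norm mulr_suml; apply: ler_sum => i _.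
rewrite mxE mulr_suml; apply: ler_sum => j _.
rewrite mxE big_ord1 mxE; set t := \sum_k _.
apply: le_trans (ler_norm _) _; rewrite normrM ler_wpM2l //.
have ht k : x k 0 ^+ 2 <= t.
  by rewrite /t (bigD1 k) //= lerDl sumr_ge0 // => l _; rewrite sqr_ge0.
rewrite normrM; have := sqr_ge0 (`|x j 0| - `|x i 0|).
rewrite sqrrB !real_normK ?num_real // => h.
have := ht i; have := ht j; lra.
Qed.

(** Evaluating the equation at a left eigenvector [v = a + i b] gives [Q = w + |z|^2 Q], with
    [w = |v|^2] and [Q] the form of [S] at [v]. Since [Q <= (1 + |S|) w], [|z|] stays away from 1
    uniformly in [z]. *)
Lemma lyap_eigenvalue (n : nat) (M S : 'M[R]_n) (z : R[i]) :
  psd S -> S = 1%:M + M *m S *m M^T ->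
  eigenvalue (map_mx (real_complex R) M) z ->
  complex.Re z ^+ 2 + complex.Im z ^+ 2 <= 1 - (1 + l1_norm S)^-1.
Proof.
move=> pS hS /eigenvalueP[v hv v0]; case: z hv => x y hv /=.
pose a := map_mx (@complex.Re R) v; pose b := map_mx (@complex.Im R) v.
have ReM : a *m M = x *: a - y *: b.
  apply/rowP => j; have := congr1 (fun w : 'rV_n => complex.Re (w 0 j)) hv.
  rewrite !mxE raddf_sum /= => h.
  have -> : \sum_k a 0 k * M k j =
      \sum_k complex.Re (v 0 k * (map_mx (real_complex R) M) k j).
    apply: eq_bigr => k _; rewrite !mxE.
    by case: (v 0 k) => p q /=; rewrite mulr0 subr0.
  by rewrite h; case: (v 0 j).
have ImM : b *m M = y *: a + x *: b.
  apply/rowP => j; have := congr1 (fun w : 'rV_n => complex.Im (w 0 j)) hv.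
  rewrite !mxE raddf_sum /= => h.
  have -> : \sum_k b 0 k * M k j =
      \sum_k complex.Im (v 0 k * (map_mx (real_complex R) M) k j).
    apply: eq_bigr => k _; rewrite !mxE.
    by case: (v 0 k) => p q /=; rewrite mulr0 add0r.
  by rewrite h; case: (v 0 j) => p q /=; rewrite addrC.
pose q (c d : 'rV[R]_n) := (c *m S *m d^T) 0 0.
have qE c : q c c = (c *m c^T) 0 0 + q (c *m M) (c *m M).
  rewrite /q {1}hS mulmxDr mulmxDl mulmx1 mxE; congr (_ + _).
  by rewrite trmx_mul !mulmxA.
have qL s t (c d e : 'rV[R]_n) : q (s *: c + t *: d) e = s * q c e + t * q d e.
  by rewrite /q !mulmxDl -!scalemxAl !mxE.
have qR s t (c d e : 'rV[R]_n) : q e (s *: c + t *: d) = s * q e c + t * q e d.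
  by rewrite /q linearD !linearZ /= mulmxDr -!scalemxAr !mxE.
pose w := (a *m a^T) 0 0 + (b *m b^T) 0 0.
pose Q := q a a + q b b.
(* The mixed terms in [q a b] and [q b a] cancel between the real and imaginary parts. *)
have QE : Q = w + (x ^+ 2 + y ^+ 2) * Q.
  rewrite {1}/Q qE (qE b) ReM ImM -scaleNr !qL !qR /w /Q; ring.
have w0 : 0 < w.
  rewrite /w -{1}(trmxK a) -{1}(trmxK b) !sqr_quad.
  have s0 (c : 'cV[R]_n) : 0 <= \sum_i c i 0 ^+ 2.
    by rewrite sumr_ge0 // => i _; rewrite sqr_ge0.
  rewrite lt0r addr_ge0 // andbT paddr_eq0 //; apply: contra v0.
  rewrite !psumr_eq0 => [|i _|i _]; rewrite ?sqr_ge0 //.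
  move=> /andP[/allP ha /allP hb]; apply/eqP/rowP => i; rewrite mxE.
  have := ha i (mem_index_enum i); have := hb i (mem_index_enum i).
  rewrite /= !expf_eq0 /= !mxE; case: (v 0 i) => p r /= /eqP -> /eqP ->.
  by [].
have Qw : Q <= (1 + l1_norm S) * w.
  apply: (@le_trans _ _ (l1_norm S * w)); last first.
    by apply: ler_wpM2r; [exact: ltW | rewrite lerDr].
  rewrite /Q /q /w mulrDr lerD //.
    by have := psd_bound S a^T; rewrite trmxK.
  by have := psd_bound S b^T; rewrite trmxK.
have s1 : 0 < 1 + l1_norm S by rewrite ltr_pwDl // l1_norm_ge0.
have Q0 : 0 < Q.
  have Qge : 0 <= Q.
    by have := pS a^T; have := pS b^T; rewrite !trmxK => h1 h2; exact: addr_ge0.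
  apply: lt_le_trans w0 _; rewrite QE lerDl; apply: mulr_ge0 => //.
  by rewrite addr_ge0 ?sqr_ge0.
rewrite -(ler_pM2r Q0) mulrBl mul1r.
have : (1 + l1_norm S)^-1 * Q <= w by rewrite mulrC ler_pdivrMr // mulrC.
move: QE; set c := (1 + l1_norm S)^-1 * Q; set d := (_ + _) * Q; lra.
Qed.

(** The eigenvalue bound is uniform, so strictness survives the supremum; an empty spectrum has
    supremum 0. *)
Lemma lyap_spectral_radius (n : nat) (M S : 'M[R]_n) :
  psd S -> S = 1%:M + M *m S *m M^T -> spectral_radius M < 1.
Proof.
move=> pS hS; rewrite /spectral_radius; set E := [set _ | _ in _].
have s1 : 0 < 1 + l1_norm S by rewrite ltr_pwDl // l1_norm_ge0.
apply: (@le_lt_trans _ _ (Num.sqrt (1 - (1 + l1_norm S)^-1))); last first.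
  by rewrite -[ltRHS]sqrtr1 ltr_sqrt // ltrBlDr ltrDl invr_gt0.
have [E0|/set0P/negP/negPn/eqP ->] := pselect (E !=set0); last first.
  by rewrite sup0 sqrtr_ge0.
apply: ge_sup => // _ [z hz <-].
have := lyap_eigenvalue pS hS hz; case: {hz} z => x y /=.
exact: ler_wsqrtr.
Qed.

Lemma stable_lyap (n : nat) (M S : 'M[R]_n) : spectral_radius M < 1 ->
  S = 1%:M + M *m S *m M^T ->
  [/\ S^T = S, dual_psd S & dual_psd (S - 1%:M)].
Proof.
move=> /spectral_radius_small_powers hM hS.
have dS := dual_psd_lyap hM (@dual_psd1 _ _) hS.
split=> //; last exact: dual_psd_lyap_sub1 hS.
by apply: lyap_sym (small_powers_det hM) _ hS; rewrite trmx1.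
Qed.

End LyapunovSpectrum.

(** * Cost differences and the gradient formula *)

Section Cost.
Context {R : realType} {n m T : nat}.
Variables (Q : 'M[R]_n) (W : 'M[R]_m) (Um : 'M[R]_(m, T)) (Xp : 'M[R]_(n, T)).
Hypothesis sW : W^T = W.
Local Notation J := (lqr_cost Q W Um Xp).
Local Notation lyapX G := (lyap_mx (Xp *m G)).

Lemma SigmaE G : Sigma Xp G =
  xget 0 [set S | S = 1%:M + Xp *m G *m S *m (Xp *m G)^T].
Proof.
by rewrite /Sigma; congr xget; apply/funext => S; rewrite /= trmx_mul -!mulmxA.
Qed.

(** Assuming only an invertible Lyapunov operator gives the equation on a whole neighbourhood of a
    stable point, as differentiation requires. *)
Lemma Sigma_lyap G : \det (lyapX G) != 0 ->
  Sigma Xp G = 1%:M + Xp *m G *m Sigma Xp G *m (Xp *m G)^T.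
Proof.
move=> hd; have [S hS] := lyap_exists 1%:M hd.
by rewrite SigmaE; apply: (@xgetPex _ 0 [set S | S = _ + _]); exists S.
Qed.

(** By duality [J G = tr P]; writing the identity as [Sigma' - M' Sigma' M'^T], with [M'] the closed
    loop of [G'], puts both costs against the same [Sigma']. *)
Lemma lqr_cost_sub G G' P : \det (lyapX G) != 0 -> \det (lyapX G') != 0 ->
  P = Q + G^T *m Um^T *m W *m Um *m G + (Xp *m G)^T *m P *m (Xp *m G) ->
  let L := Um^T *m W *m Um + Xp^T *m P *m Xp in
  J G' - J G = \tr ((G'^T *m L *m G' - G^T *m L *m G) *m Sigma Xp G').
Proof.
move=> hG hG' hP L.
have hS := Sigma_lyap hG; have hS' := Sigma_lyap hG'.
have JG : J G = \tr P.
  by rewrite /lqr_cost -(lyap_duality hP hS) mulmx1.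
have LE H : H^T *m L *m H =
    H^T *m Um^T *m W *m Um *m H + (Xp *m H)^T *m P *m (Xp *m H).
  by rewrite /L mulmxDr mulmxDl trmx_mul !mulmxA.
rewrite JG -[P in \tr P]mulmx1.
have -> : 1%:M = Sigma Xp G' - Xp *m G' *m Sigma Xp G' *m (Xp *m G')^T.
  by rewrite {1}hS' addrK.
rewrite mulmxBr linearB /=.
have -> : \tr (P *m (Xp *m G' *m Sigma Xp G' *m (Xp *m G')^T)) =
    \tr ((Xp *m G')^T *m P *m (Xp *m G') *m Sigma Xp G').
  by rewrite !mulmxA mxtrace_mulC !mulmxA.
have -> : G'^T *m L *m G' - G^T *m L *m G =
    Q + G'^T *m Um^T *m W *m Um *m G' - P + (Xp *m G')^T *m P *m (Xp *m G').
  have aux (q a b c d : 'M[R]_n) : a + b - (c + d) = q + a - (q + c + d) + b.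
    by rewrite -[q + c + d]addrA (opprD q) addrACA subrr add0r addrAC.
  by rewrite !LE {3}hP; exact: aux.
by rewrite mulmxDl mulmxBl mxtraceD [\tr (_ - _)]linearB /= opprB addrA [RHS]addrAC.
Qed.

(** The two cross terms of the expanded quadratic have equal traces because [L] and [Sigma] are
    symmetric. *)
Lemma lqr_cost_subE G H P : \det (lyapX G) != 0 -> \det (lyapX (H + G)) != 0 ->
  P^T = P ->
  P = Q + G^T *m Um^T *m W *m Um *m G + (Xp *m G)^T *m P *m (Xp *m G) ->
  let L := Um^T *m W *m Um + Xp^T *m P *m Xp in
  J (H + G) - J G = 2 * \tr (H^T *m L *m G *m Sigma Xp (H + G))
    + \tr (H^T *m L *m H *m Sigma Xp (H + G)).
Proof.
move=> hG hG' sP hP L; rewrite (lqr_cost_sub hG hG' hP) -/L.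
have sS : (Sigma Xp (H + G))^T = Sigma Xp (H + G).
  by apply: lyap_sym hG' _ (Sigma_lyap hG'); rewrite trmx1.
have sL : L^T = L.
  by rewrite /L linearD /= !trmx_mul !trmxK sW sP !mulmxA.
have -> : (H + G)^T *m L *m (H + G) - G^T *m L *m G =
    H^T *m L *m G + G^T *m L *m H + H^T *m L *m H.
  rewrite [(H + G)^T]linearD /= !mulmxDl !mulmxDr.
  by rewrite addrA addrK [RHS]addrC addrA.
rewrite !mulmxDl !mxtraceD; congr (_ + _).
rewrite mulr_natl mulr2n; congr (_ + _).
rewrite -[LHS]mxtrace_tr !trmx_mul trmxK sL sS mxtrace_mulC !mulmxA //.
Qed.

(** The difference quotient is an exact expression in [h] and [Sigma] at the moved point, so
    continuity of [Sigma] suffices. *)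
Lemma gradient_lqr_cost G P : \det (lyapX G) != 0 -> P^T = P ->
  P = Q + G^T *m Um^T *m W *m Um *m G + (Xp *m G)^T *m P *m (Xp *m G) ->
  gradient J G =
    2 *: ((Um^T *m W *m Um + Xp^T *m P *m Xp) *m G *m Sigma Xp G).
Proof.
move=> hG sP hP; set L := Um^T *m W *m Um + _.
apply/matrixP => i j; rewrite [LHS]mxE /derive.
pose D : 'M[R]_(T, n) := delta_mx i j; rewrite -/D.
pose g (h : R^o) := h *: D + G; pose S h := Sigma Xp (g h).
have g0 : g 0 = G by rewrite /g scale0r add0r.
have cg : mx_continuous (fun h => Xp *m g h).
  apply: mx_continuous_mul; first exact: mx_continuous_cst.
  apply: mx_continuousD; last exact: mx_continuous_cst.
  apply: mx_continuousZ; last exact: mx_continuous_cst.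
  by move=> x; exact: cvg_id.
have hd0 : \det (lyap_mx (Xp *m g 0)) != 0 by rewrite g0.
have [nd cS] := lyap_cvg (S := S) cg hd0 (fun h => @Sigma_lyap (g h)).
have tcvg (N : 'M[R]_n) :
    \tr (N *m S h) @[h --> (0 : R^o)] --> (\tr (N *m S 0) : R^o).
  rewrite /mxtrace; apply: cvg_big; first exact: add_continuous.
  move=> a _; under eq_cvg do rewrite mxE; rewrite mxE.
  apply: cvg_big; first exact: add_continuous.
  by move=> b _; apply: cvgM; [exact: cvg_cst | exact: cS].
(* The vanishing summand is the second-order term at [h = 0]; it gives the limit the same shape as
   the quotient. *)
have -> : (2 *: (L *m G *m Sigma Xp G)) i j =
    2 * \tr (D^T *m L *m G *m S 0) + 0 * \tr (D^T *m L *m D *m S 0).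
  rewrite mul0r addr0 mxE /S g0; congr (_ * _).
  rewrite -!mulmxA mxtrace_mulC; move: (L *m _) => Y.
  rewrite /mxtrace (bigD1 i) //= big1 ?addr0 => [|k ki].
    rewrite [X in _ = X]mxE (bigD1 j) //= big1 ?addr0 => [|k kj].
      by rewrite !mxE !eqxx mulr1.
    by rewrite !mxE (negbTE kj) andbF mulr0.
  by rewrite mxE big1 // => k' _; rewrite !mxE (negbTE ki) mulr0.
apply: cvg_lim => //.
apply: (@cvg_trans _ ((2 * \tr (D^T *m L *m G *m S h) +
    h * \tr (D^T *m L *m D *m S h)) @[h --> (0 : R^o)^'])).
  apply: near_eq_cvg; rewrite near_withinE; near=> h => h0.
  have hd : \det (lyap_mx (Xp *m (h *: D + G))) != 0 by near: h; exact: nd.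
  rewrite /= /shift (lqr_cost_subE hG hd sP hP) -/L /S -/(g h).
  rewrite [(h *: D)^T]linearZ /= -!scalemxAl -scalemxAr -scalemxAl !mxtraceZ.
  by rewrite /GRing.scale /=; field.
apply: cvg_within_filter; apply: cvgD.
  by apply: cvgM; [exact: cvg_cst | exact: tcvg].
by apply: cvgM; [exact: cvg_id | exact: tcvg].
Unshelve. all: by end_near. Qed.

End Cost.

(** * Bounds and existence of a minimizer *)

Section Bounds.
Context {R : realType}.

Lemma ler_l1_normB (p q : nat) (M N : 'M[R]_(p, q)) :
  l1_norm (M - N) <= l1_norm M + l1_norm N.
Proof.
rewrite /l1_norm -big_split; apply: ler_sum => i _.
rewrite -big_split; apply: ler_sum => j _.
by rewrite !mxE ler_normB.
Qed.

Lemma ler_entry_euclidean_norm (n : nat) (x : 'cV[R]_n) i :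
  `|x i 0| <= euclidean_norm x.
Proof.
rewrite -sqrtr_sqr ler_wsqrtr // (bigD1 i) //= lerDl sumr_ge0 // => j _.
exact: sqr_ge0.
Qed.

Lemma euclidean_norm0 (n : nat) : euclidean_norm (0 : 'cV[R]_n) = 0.
Proof.
by rewrite /euclidean_norm big1 ?sqrtr0 // => i _; rewrite mxE expr0n.
Qed.

Lemma ler_spectral_norm (p q : nat) (M : 'M[R]_(p, q)) x :
  euclidean_norm x <= 1 -> euclidean_norm (M *m x) <= spectral_norm M.
Proof.
move=> x1; apply: sup_upper_bound; last by exists x.
split; first by exists (euclidean_norm (M *m x)), x.
(* A crude bound, needed only to know that the supremum is finite. *)
exists (Num.sqrt (\sum_(k < p) l1_norm M ^+ 2)) => _ [{x1}x x1 <-].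
apply: ler_wsqrtr; apply: ler_sum => k _.
rewrite -real_normK ?num_real // ler_pXn2r ?nnegrE ?l1_norm_ge0 //.
rewrite mxE; apply: le_trans (ler_norm_sum _ _ _) _.
apply: (@le_trans _ _ (\sum_l `|M k l|)).
  apply: ler_sum => l _; rewrite normrM ler_piMr //.
  exact: le_trans (ler_entry_euclidean_norm _ _) x1.
rewrite /l1_norm [leRHS](bigD1 k) //= lerDl.
by rewrite sumr_ge0 // => b _; rewrite sumr_ge0.
Qed.

Lemma spectral_norm_ge0 (p q : nat) (M : 'M[R]_(p, q)) : 0 <= spectral_norm M.
Proof.
have := @ler_spectral_norm _ _ M 0; rewrite mulmx0 !euclidean_norm0; exact.
Qed.

Lemma ler_entry_spectral_norm (p q : nat) (M : 'M[R]_(p, q)) i j :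
  `|M i j| <= spectral_norm M.
Proof.
have -> : M i j = (M *m (delta_mx j 0 : 'cV_q)) i 0 by rewrite -colE mxE.
apply: le_trans (ler_entry_euclidean_norm _ _) (ler_spectral_norm _ _).
rewrite /euclidean_norm (bigD1 j) //= big1 => [|k kj].
  by rewrite mxE !eqxx expr1n addr0 sqrtr1.
by rewrite mxE (negbTE kj) expr0n.
Qed.

(** Test the form on [e_i + e_j] and [e_i - e_j], and bound diagonal entries by the trace. *)
Lemma psd_entry_bound (n : nat) (S : 'M[R]_n) i j :
  S^T = S -> psd S -> `|S i j| <= \tr S.
Proof.
move=> sS pS.
have d0 k : 0 <= S k k.
  by have := pS (delta_mx k 0); rewrite trmx_delta -rowE -colE !mxE.
have dt k : S k k <= \tr S.
  by rewrite /mxtrace (bigD1 k) //= lerDl sumr_ge0.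
have Sji : S j i = S i j by rewrite -{1}sS mxE.
pose v c : 'cV[R]_n := delta_mx i 0 + c *: delta_mx j 0.
have E c : ((v c)^T *m S *m v c) 0 0 = S i i + 2 * c * S i j + c ^+ 2 * S j j.
  rewrite /v [_^T]linearD /= [(c *: _)^T]linearZ /= !trmx_delta.
  rewrite mulmxDl mulmxDr !mulmxDl -!scalemxAl.
  rewrite -!scalemxAr -!rowE -!colE !mxE Sji; ring.
have := pS (v 1); have := pS (v (-1)).
rewrite !E; have := dt i; have := dt j.
rewrite ler_norml => *; apply/andP; split; lra.
Qed.

(** Coercivity of [Q] bounds [tr S]; [S >= 1] and coercivity of [W] bound the sum of squares of
    [K]. *)
Lemma lqr_bounds (n m : nat) (Q : 'M[R]_n) (W : 'M[R]_m) (a : R) :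
  symposdef Q -> symposdef W ->
  exists c, forall (K : 'M[R]_(m, n)) (S : 'M[R]_n),
    S^T = S -> dual_psd S -> dual_psd (S - 1%:M) ->
    \tr ((Q + K^T *m W *m K) *m S) <= a -> l1_norm K <= c /\ l1_norm S <= c.
Proof.
move=> hQ hW.
have [q [q0 hq]] := symposdef_coercive hQ.
have [w [w0 hw]] := symposdef_coercive hW.
(* Entry bounds times the number of entries: [K_ij^2 <= a / w] gives [|K_ij| <= 1 + a / w] without a
   root, and entries of [S] are at most [tr S <= a / q]. *)
pose c1 := (1 + a / w) *+ (n * m); pose c2 := (a / q) *+ (n * n).
exists (Num.max c1 c2) => K S sS dS dS1 hJ.
pose N := K^T *m W *m K.
have pN : psd N by apply: psd_congr; exact: symposdef_psd.
have JE : \tr ((Q + N) *m S) = \tr (Q *m S) + \tr (N *m S).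
  by rewrite mulmxDl mxtraceD.
have hQS : q * \tr S <= \tr (Q *m S).
  have := dS _ hq; rewrite mulmxBl mul_scalar_mx.
  by rewrite [\tr (_ - _)]linearB /= mxtraceZ subr_ge0.
have hNS : \tr N <= \tr (N *m S).
  have := dS1 _ pN; rewrite mulmxBr mulmx1.
  by rewrite [\tr (_ - _)]linearB /= subr_ge0.
have hN : w * \tr (K^T *m K) <= \tr N.
  have := @dual_psd1 R n _ (psd_congr K hw).
  rewrite mulmx1 mulmxBr mulmxBl mul_mx_scalar -scalemxAl.
  by rewrite [\tr (_ - _)]linearB /= mxtraceZ subr_ge0.
have trS : 0 <= \tr S.
  by have := dS _ (@psd1 _ _); rewrite mul1mx.
have KK : \tr (K^T *m K) = \sum_j \sum_i K i j ^+ 2.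
  by apply: eq_bigr => j _; rewrite mxE; apply: eq_bigr => i _; rewrite mxE expr2.
have KK0 : 0 <= \tr (K^T *m K).
  by rewrite KK sumr_ge0 // => j _; rewrite sumr_ge0 // => i _; rewrite sqr_ge0.
have trSa : \tr S <= a / q.
  rewrite ler_pdivlMr // mulrC; apply: le_trans hQS _.
  apply: le_trans hJ; rewrite JE lerDl; apply: le_trans hNS; apply: le_trans hN.
  by rewrite mulr_ge0 // ltW.
have KKa : \tr (K^T *m K) <= a / w.
  rewrite ler_pdivlMr // mulrC; apply: le_trans hN _; apply: le_trans hNS _.
  apply: le_trans hJ; rewrite JE lerDr; apply: le_trans hQS.
  by rewrite mulr_ge0 // ltW.
split; rewrite le_max.
  apply/orP; left; apply: l1_norm_le => i j.
  have hK : K i j ^+ 2 <= a / w.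
    apply: le_trans KKa; rewrite KK (bigD1 j) //= (bigD1 i) //= -addrA lerDl.
    rewrite addr_ge0 ?sumr_ge0 // => [k _|k _]; first exact: sqr_ge0.
    by rewrite sumr_ge0 // => l _; exact: sqr_ge0.
  have := sqr_ge0 (`|K i j| - 1); rewrite sqrrB real_normK ?num_real // mulr1.
  have := normr_ge0 (K i j); lra.
apply/orP; right; apply: l1_norm_le => i j.
by apply: le_trans trSa; apply: psd_entry_bound => //; exact: dual_psd_psd.
Qed.

(** For the column [y] of index [j] of the inverse, [|y|^2 <= y^T S y = y_j]; hence [y_j <= 1], and
    every entry of [y] is at most 1 in absolute value. *)
Lemma invmx_bound (n : nat) (S : 'M[R]_n) : S^T = S -> psd (S - 1%:M) ->
  S \in unitmx /\ l1_norm (invmx S) <= 1 *+ (n * n).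
Proof.
move=> sS pS.
have hx (x : 'cV[R]_n) : (x^T *m x) 0 0 <= (x^T *m S *m x) 0 0.
  have := pS x; rewrite mulmxBr mulmxBl mulmx1 mxE.
  by rewrite [X in _ + X]mxE subr_ge0.
have uS : S \in unitmx.
  apply: symposdef_unitmx; split=> // x x0; apply: lt_le_trans (hx x).
  rewrite sqr_quad lt0r sumr_ge0 ?andbT => [|i _]; last exact: sqr_ge0.
  apply: contra x0; rewrite psumr_eq0 => [/allP h|i _]; last exact: sqr_ge0.
  apply/eqP/colP => i; rewrite mxE.
  by have := h i (mem_index_enum i); rewrite /= expf_eq0 /= => /eqP.
split=> //; apply: l1_norm_le => i j.
pose y : 'cV[R]_n := col j (invmx S).
have Sy : S *m y = delta_mx j 0 by rewrite /y colE mulmxA mulmxV // mul1mx.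
have := hx y; rewrite -mulmxA Sy -colE sqr_quad [leRHS]mxE mxE => h.
have hy k : y k 0 ^+ 2 <= y j 0.
  apply: le_trans h; rewrite (bigD1 k) //= lerDl sumr_ge0 // => l _.
  exact: sqr_ge0.
have := hy i; have := hy j; rewrite [y i 0]mxE.
move: (y j 0) (invmx S i j) => s t h1 h2.
have s1 : s <= 1 by have := sqr_ge0 (s - 1); rewrite sqrrB mulr1; nra.
rewrite -(expr_le1 (_ : 0 < 2)%N) // real_normK ?num_real //.
exact: le_trans s1.
Qed.

End Bounds.

(** * Existence of an optimal gain *)

Section Minimum.
Context {R : realType} {n m : nat}.
Variables (A : 'M[R]_n) (B : 'M[R]_(n, m)) (Q : 'M[R]_n) (W : 'M[R]_m).
Hypotheses (hQ : symposdef Q) (hW : symposdef W).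

Definition gain_cost (K : 'M[R]_(m, n)) (S : 'M[R]_n) : R :=
  \tr ((Q + K^T *m W *m K) *m S).

(** Stability is expressed by a semidefinite Lyapunov solution, a closed condition on the pair, in
    place of the strict inequality on the spectral radius. *)
Definition admissible (K : 'M[R]_(m, n)) (S : 'M[R]_n) : Prop :=
  S = 1%:M + (A + B *m K) *m S *m (A + B *m K)^T /\ dual_psd S.

Lemma admissible_stable (K : 'M[R]_(m, n)) (S : 'M[R]_n) :
  admissible K S -> spectral_radius (A + B *m K) < 1.
Proof. by move=> [hS /dual_psd_psd pS]; exact: lyap_spectral_radius hS. Qed.

Lemma gain_cost_min K0 S0 : admissible K0 S0 ->
  exists K S, admissible K S /\
    forall K' S', admissible K' S' -> gain_cost K S <= gain_cost K' S'.
Proof.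
move=> ad0; pose a := gain_cost K0 S0.
(* Pairs are encoded as row vectors, where boxes are compact. *)
pose V := 'rV[R]_(m * n + n * n).
pose k (u : V) : 'M[R]_(m, n) := vec_mx (lsubmx u).
pose s (u : V) : 'M[R]_n := vec_mx (rsubmx u).
pose enc K S : V := row_mx (mxvec K) (mxvec S).
have kE K S : k (enc K S) = K by rewrite /k row_mxKl mxvecK.
have sE K S : s (enc K S) = S by rewrite /s row_mxKr mxvecK.
have ck : mx_continuous k.
  apply: mx_continuous_vec_mx => i j.
  by under [X in continuous X]eq_fun do rewrite mxE; exact: coord_continuous.
have cs : mx_continuous s.
  apply: mx_continuous_vec_mx => i j.
  by under [X in continuous X]eq_fun do rewrite mxE; exact: coord_continuous.
have ccst p q (N : 'M[R]_(p, q)) : mx_continuous (fun _ : V => N).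
  exact: mx_continuous_cst.
pose J u : R^o := gain_cost (k u) (s u).
have cJ : continuous J.
  apply: continuous_mxtrace; apply: mx_continuous_mul => //.
  apply: mx_continuousD => //; apply: mx_continuous_mul => //.
  by apply: mx_continuous_mul => //; exact: mx_continuous_tr.
pose C : set V := [set u | admissible (k u) (s u) /\ J u <= a].
have clC : closed C.
  pose D u := s u - (1%:M + (A + B *m k u) *m s u *m (A + B *m k u)^T).
  have cD : mx_continuous D.
    have cM : mx_continuous (fun u => A + B *m k u).
      by apply: mx_continuousD => //; exact: mx_continuous_mul.
    apply: mx_continuousB => //; apply: mx_continuousD => //.
    apply: mx_continuous_mul; last exact: mx_continuous_tr.
    exact: mx_continuous_mul.
  have -> : C = (\bigcap_(ij in [set: 'I_n * 'I_n])
        (fun u => D u ij.1 ij.2 : R^o) @^-1` [set x | x = 0])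
      `&` (\bigcap_(N in [set N | psd N])
        (fun u => \tr (N *m s u) : R^o) @^-1` [set x | 0 <= x])
      `&` (J @^-1` [set x | x <= a]).
    apply/seteqP; split=> u /=.
      move=> [[hS dS] hJ]; split=> //; split=> [[i j] _ /=|N pN]; last exact: dS.
      by rewrite /D -hS subrr mxE.
    move=> [[hD dS] hJ]; split=> //; split=> //.
    apply/eqP; rewrite -subr_eq0; apply/eqP/matrixP => i j.
    by rewrite [RHS]mxE; exact: (hD (i, j)).
  apply: closedI; first apply: closedI.
  - apply: closed_bigI => -[i j] _.
    apply: (@preimage_closed V R^o (fun u => D u i j) [set x | x = 0]).
      by move=> x _; exact: cD.
    exact: closed_eq.
  - apply: closed_bigI => N _.
    apply: (@preimage_closed V R^o (fun u => \tr (N *m s u)) [set x | 0 <= x]).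
      by move=> x _; apply: continuous_mxtrace; exact: mx_continuous_mul.
    exact: closed_ge.
  - apply: (@preimage_closed V R^o J [set x | x <= a]); last exact: closed_le.
    by move=> x _; exact: cJ.
have [c hc] := lqr_bounds a hQ hW.
have coC : compact C.
  apply: (subclosed_compact clC
      (B := [set u : V | forall i, `[- c, c]%classic (u ord0 i)])).
    apply: (@rV_compact R^o _ (fun=> `[- c, c]%classic)) => _.
    exact: segment_compact.
  move=> u [ad hJ] i /=; rewrite in_itv /= -ler_norml.
  have [sS dS dS1] := stable_lyap (admissible_stable ad) ad.1.
  have [hk hs] := hc _ _ sS dS dS1 hJ.
  have -> : u = enc (k u) (s u) by rewrite /enc /k /s !vec_mxK hsubmxK.
  rewrite /enc mxE; case: fintype.split => l.
    case/mxvec_indexP: l => x y; rewrite mxvecE.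
    exact: le_trans (ler_entry_l1_norm _ _ _) hk.
  case/mxvec_indexP: l => x y; rewrite mxvecE.
  exact: le_trans (ler_entry_l1_norm _ _ _) hs.
have C0 : C !=set0 by exists (enc K0 S0); rewrite /C /= /J kE sE.
have [u uC hmin] := compact_EVT_min C0 coC (continuous_subspaceT cJ).
move: uC; rewrite inE => -[adu hu].
exists (k u), (s u); split=> // K' S' ad'.
(* Pairs outside the sublevel set of the initial cost [a] cannot beat the minimizer inside it. *)
have [h|h] := leP (gain_cost K' S') a; last exact: le_trans hu (ltW h).
have := hmin (enc K' S'); rewrite inE /C /= /J kE sE; exact.
Qed.

End Minimum.

(** * Gradient dominance *)

Lemma set_minE (R : realType) (E : set R) (x : R) :
  E x -> lbound E x -> set_min E = x.
Proof.
move=> Ex lx; apply: xget_unique => [//|y [Ey ly]].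
by apply: le_anti; rewrite lx // ly.
Qed.

(** The pseudo-inverse begins with [X^T], which [H^T] annihilates; feasible directions thus see only
    the projected gradient. *)
Lemma null_proj_fix (R : realType) (p q r : nat) (X : 'M[R]_(p, q))
    (H : 'M[R]_(q, r)) : X *m H = 0 -> H^T *m null_proj X = H^T.
Proof.
move=> XH; rewrite mulmxBr mulmx1 /right_pinv !mulmxA -trmx_mul XH trmx0.
by rewrite !mul0mx subr0.
Qed.

Section DataDriven.
Context {R : realType} {n m T : nat}.
Variables (A : 'M[R]_n) (B : 'M[R]_(n, m)) (Q : 'M[R]_n) (W : 'M[R]_m).
Variables (Xm : 'M[R]_(n, T)) (Um : 'M[R]_(m, T)) (Xp : 'M[R]_(n, T)).
Hypotheses (hQ : symposdef Q) (hW : symposdef W).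
Hypothesis hX : Xp = A *m Xm + B *m Um.
Local Notation J := (lqr_cost Q W Um Xp).
Local Notation feas := (feasible Xm Xp).

Lemma closed_loopE G : Xm *m G = 1%:M -> Xp *m G = A + B *m (Um *m G).
Proof. by move=> h; rewrite hX mulmxDl -!mulmxA h mulmx1. Qed.

Lemma feasible_det G : feas G -> \det (lyap_mx (Xp *m G)) != 0.
Proof. by move=> [_ /spectral_radius_small_powers /small_powers_det]. Qed.

Lemma feasible_admissible G : feas G ->
  admissible A B (Um *m G) (Sigma Xp G).
Proof.
move=> hG; have hS := Sigma_lyap (feasible_det hG).
have [_ dS _] := stable_lyap hG.2 hS.
by split=> //; rewrite -closed_loopE //; case: hG.
Qed.

(** The way back from an optimal pair to data: the Lyapunov solution certifies stability, and
    uniqueness identifies it with [Sigma]. *)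
Lemma admissible_feasible G S : Xm *m G = 1%:M ->
  admissible A B (Um *m G) S -> feas G /\ Sigma Xp G = S.
Proof.
move=> XG ad; have hG : feas G.
  by split=> //; rewrite closed_loopE //; exact: admissible_stable ad.
split=> //; apply: lyap_uniq (feasible_det hG) (Sigma_lyap (feasible_det hG)) _.
by rewrite closed_loopE //; case: ad.
Qed.

Lemma lqr_costE G : J G = gain_cost Q W (Um *m G) (Sigma Xp G).
Proof. by rewrite /lqr_cost /gain_cost trmx_mul !mulmxA. Qed.

Lemma cost_gradient_bound G G' : feas G -> feas G' ->
  J G - J G' <=
    l1_norm (G' - G) * l1_norm (null_proj Xm *m gradient J G) *
    l1_norm (invmx (Sigma Xp G)) * l1_norm (Sigma Xp G').
Proof.
move=> hG hG'; set H := G' - G.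
have GH : G' = H + G by rewrite subrK.
have dG := feasible_det hG; have dG' := feasible_det hG'.
have [sS dS dS1] := stable_lyap hG.2 (Sigma_lyap dG).
have [sS' dS' _] := stable_lyap hG'.2 (Sigma_lyap dG').
have [uS _] := invmx_bound sS (dual_psd_psd dS1).
have hM : small_powers (Xp *m G) := spectral_radius_small_powers hG.2.
have hM' : \det (lyap_mx (Xp *m G)^T) != 0.
  exact: small_powers_det (small_powers_tr hM).
pose Z := Q + G^T *m Um^T *m W *m Um *m G.
have [P] := lyap_exists Z hM'; rewrite trmxK => hP.
have sZ : Z^T = Z.
  by rewrite /Z linearD /= hQ.1 !trmx_mul !trmxK hW.1 !mulmxA.
have sP : P^T = P by apply: (lyap_sym hM' sZ); rewrite trmxK.
have pZ : psd Z.
  apply: psdD; first exact: symposdef_psd.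
  have := psd_congr (Um *m G) (symposdef_psd hW).
  by rewrite trmx_mul !mulmxA.
have pP := psd_lyap hM pZ hP.
have hH : Xm *m H = 0 by rewrite mulmxBr hG.1 hG'.1 subrr.
have dHG : \det (lyap_mx (Xp *m (H + G))) != 0 by rewrite -GH.
have := lqr_cost_subE hW.1 dG dHG sP hP; rewrite -GH.
set L := Um^T *m W *m Um + _ => /= JE.
have pL : psd L by apply: psdD; apply: psd_congr => //; exact: symposdef_psd.
have h2 : 0 <= \tr (H^T *m L *m H *m Sigma Xp G') by apply: dS'; exact: psd_congr.
set D := null_proj Xm *m gradient J G.
(* [2 L G] is the gradient times the inverse of [Sigma G], and [H^T] absorbs the projection. *)
have h1 : 2 * \tr (H^T *m L *m G *m Sigma Xp G') =
    \tr (H^T *m D *m invmx (Sigma Xp G) *m Sigma Xp G').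
  rewrite /D (gradient_lqr_cost hW.1 dG sP hP) -/L mulmxA null_proj_fix //.
  by rewrite -scalemxAr -!scalemxAl mxtraceZ !mulmxA mulmxK.
have : J G - J G' <= - \tr (H^T *m D *m invmx (Sigma Xp G) *m Sigma Xp G').
  by move: h1 h2 JE; lra.
move/le_trans; apply; apply: le_trans (ler_norm _) _; rewrite normrN.
apply: le_trans (ler_norm_mxtrace _) _.
apply: le_trans (ler_l1_norm_mul _ _) _; rewrite ler_wpM2r ?l1_norm_ge0 //.
apply: le_trans (ler_l1_norm_mul _ _) _; rewrite ler_wpM2r ?l1_norm_ge0 //.
by apply: le_trans (ler_l1_norm_mul _ _) _; rewrite l1_norm_tr.
Qed.

End DataDriven.

Theorem lemma4 (R : realType) (n m T : nat)
  (A : 'M[R]_n) (B : 'M[R]_(n, m)) (Q : 'M[R]_n) (W : 'M[R]_m)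
  (Xm : 'M[R]_(n, T)) (Um : 'M[R]_(m, T)) (Xp : 'M[R]_(n, T))
  (hAB : controllable A B)
  (hQ : symposdef Q) (hW : symposdef W)
  (hX : Xp = A *m Xm + B *m Um)
  (hD : row_free (col_mx Um Xm)) :
  forall a : R, 0 < a ->
  exists mu : R, 0 < mu /\
    forall G : 'M[R]_(T, n), sublevel Q W Xm Um Xp a G ->
      lqr_cost Q W Um Xp G - optimal_cost Q W Xm Um Xp
        <= mu * spectral_norm (null_proj Xm *m gradient (lqr_cost Q W Um Xp) G).
Proof.
move=> a a0.
(* On an empty sublevel set any constant works; otherwise [G0] supplies the initial pair for the
   minimization. *)
have [[G0 [fG0 _]]|noG] :=
  pselect (exists G, sublevel Q W Xm Um Xp a G); last first.
  by exists 1; split=> // G hG; case: noG; exists G.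
have [K [S [ad hmin]]] := gain_cost_min hQ hW (feasible_admissible hX fG0).
(* Full row rank of the data lets both products [Um G] and [Xm G] be prescribed. *)
have hDZ r (U : 'M[R]_(m, r)) (X : 'M[R]_(n, r)) :
    Um *m (pinvmx (col_mx Um Xm) *m col_mx U X) = U /\
    Xm *m (pinvmx (col_mx Um Xm) *m col_mx U X) = X.
  apply: eq_col_mx; rewrite -mul_col_mx mulmxA mulmxVp // mul1mx.
  by [].
set Z := pinvmx _ in hDZ.
have optE G : Xm *m G = 1%:M -> Um *m G = K ->
    [/\ feasible Xm Xp G, Sigma Xp G = S &
        lqr_cost Q W Um Xp G = optimal_cost Q W Xm Um Xp].
  move=> XG UG; have := ad; rewrite -UG => /(admissible_feasible hX XG) [fG SG].
  split=> //; apply/esym/set_minE; first by exists G.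
  move=> _ [G' fG' <-]; rewrite !lqr_costE UG SG; apply: hmin.
  exact: feasible_admissible fG'.
pose V := Z *m col_mx (1%:M : 'M[R]_m) (0 : 'M[R]_(n, m)).
have [UV XV] : Um *m V = 1%:M /\ Xm *m V = 0 by exact: hDZ.
have [c hc] := lqr_bounds a hQ hW.
(* The factors bound, in order, [G' - G], the [n * T] entries of the projected gradient, the inverse
   of [Sigma G], and [Sigma G' = S]. *)
pose mu := l1_norm V * (l1_norm K + `|c|) * (n * T)%:R * (n * n)%:R * l1_norm S.
have mu0 : 0 <= mu by rewrite !mulr_ge0 ?addr_ge0 ?l1_norm_ge0.
exists (1 + mu); split; first by rewrite ltr_pwDl.
move=> G [fG JG]; have [XG _] := fG.
(* Changes the gain of [G] to the optimal [K] while keeping [Xm G = 1]. *)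
pose G' := V *m (K - Um *m G) + G.
have XG' : Xm *m G' = 1%:M by rewrite mulmxDr mulmxA XV mul0mx add0r.
have UG' : Um *m G' = K by rewrite mulmxDr mulmxA UV mul1mx subrK.
have [fG' SG' JG'] := optE _ XG' UG'.
rewrite -JG'; apply: le_trans (cost_gradient_bound Um hQ hW fG fG') _.
rewrite SG' addrK; set D := null_proj _ *m _.
have hD1 : l1_norm D <= spectral_norm D *+ (n * T).
  by apply: l1_norm_le => i j; exact: ler_entry_spectral_norm.
have [sS dS dS1] := stable_lyap fG.2 (Sigma_lyap (feasible_det fG)).
have [_ hY] := invmx_bound sS (dual_psd_psd dS1).
have [hK _] : l1_norm (Um *m G) <= c /\ l1_norm (Sigma Xp G) <= c.
  by apply: hc; rewrite // -/(gain_cost _ _ _ _) -lqr_costE.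
have hV : l1_norm (V *m (K - Um *m G)) <= l1_norm V * (l1_norm K + `|c|).
  apply: le_trans (ler_l1_norm_mul _ _) _; rewrite ler_wpM2l ?l1_norm_ge0 //.
  apply: le_trans (ler_l1_normB _ _) _; rewrite lerD2l.
  exact: le_trans hK (ler_norm c).
apply: (@le_trans _ _ (mu * spectral_norm D)); last first.
  by rewrite ler_wpM2r ?spectral_norm_ge0 // lerDr.
rewrite /mu [leRHS]mulrAC; apply: ler_wpM2r; first exact: l1_norm_ge0.
rewrite [leRHS]mulrAC; apply: ler_pM hY; rewrite ?mulr_ge0 ?l1_norm_ge0 //.
by rewrite -[leRHS]mulrA mulr_natl; apply: ler_pM; rewrite ?l1_norm_ge0.
Qed.
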